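(* Let $F$ be a field, let $D$ be a quaternion division algebra over $F$ and $c\in D^\times\setminus F$. Then $D$ is the only quaternion subalgebra of the algebra $A=\mathrm{Cay}(D,c)$.
   Context: For a quaternion algebra $D$ over $F$ (any characteristic) with canonical involution $x\mapsto\bar x$ and $c\in D^\times\setminus F$, $\mathrm{Cay}(D,c)$ is the $F$-vector space $D\oplus D$ with multiplication $(u,v)(u',v')=(uu'+c\,\bar{v'}v,\ v'u+v\bar{u'})$ for $u,v,u',v'\in D$ and unit $(1,0)$. $D$ is identified with the subalgebra $D\oplus 0$. A quaternion subalgebra is a (unital) $F$-subalgebra that is a quaternion algebra over $F$. *)

(* Defs.v *)
From HB Require Import structures.
From mathcomp Require Import all_boot all_order all_algebra all_field.

Set Implicit Arguments.
Unset Strict Implicit.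
Unset Printing Implicit Defensive.

Import GRing.Theory.
Local Open Scope ring_scope.

(* MathComp has no structure for nonassociative algebras: one is given here by *)
(* a vector space V, a product mul and a unit one; U is a subspace of V.       *)
Section Algebras.

Variables (F : fieldType) (V : vectType F).
Variables (mul : V -> V -> V) (one : V).

Record unital_subalgebra (U : {vspace V}) : Prop := UnitalSubalgebra {
  usub_one : one \in U;
  usub_mul : {in U &, forall x y, mul x y \in U} }.

Record assoc_unital_algebra (U : {vspace V}) : Prop := AssocUnitalAlgebra {
  aalg_sub : unital_subalgebra U;
  aalg_linl : forall a, {in U & &, forall x y z,
    mul (a *: x + y) z = a *: mul x z + mul y z};
  aalg_linr : forall a, {in U & &, forall x y z,
    mul x (a *: y + z) = a *: mul x y + mul x z};
  aalg_mul1l : {in U, forall x, mul one x = x};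
  aalg_mul1r : {in U, forall x, mul x one = x};
  aalg_assoc : {in U & &, forall x y z, mul x (mul y z) = mul (mul x y) z} }.

Definition central (U : {vspace V}) : Prop :=
  forall x, x \in U -> {in U, forall y, mul x y = mul y x} ->
  x \in <[one]>%VS.

(* Two-sided ideals of a unital algebra over a field are always subspaces.     *)
Record ideal (U I : {vspace V}) : Prop := Ideal {
  ideal_sub : (I <= U)%VS;
  ideal_mull : forall x y, x \in U -> y \in I -> mul x y \in I;
  ideal_mulr : forall x y, x \in I -> y \in U -> mul x y \in I }.

Definition simple_algebra (U : {vspace V}) : Prop :=
  U <> 0%VS /\ forall I, ideal U I -> I = 0%VS \/ I = U.

Record quaternion_algebra (U : {vspace V}) : Prop := QuaternionAlgebra {
  quat_alg : assoc_unital_algebra U;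
  quat_dim : \dim U = 4;
  quat_central : central U;
  quat_simple : simple_algebra U }.

Definition quaternion_subalgebra (U : {vspace V}) : Prop :=
  unital_subalgebra U /\ quaternion_algebra U.

End Algebras.

Section CayleyDickson.

Variables (F : fieldType) (D : falgType F).

Definition division_algebra : Prop :=
  forall x : D, x != 0 -> x \is a GRing.unit.

(* 1%VS is the line F.1, i.e., F as a subspace of D. There is at most one such *)
(* map (canonical_involution_unique below), and it exists on any quaternion    *)
(* algebra, so it may be quantified over.                                      *)
Record canonical_involution (conj : {linear D -> D}) : Prop :=
  CanonicalInvolution {
    conj_mul : forall x y, conj (x * y) = conj y * conj x;
    conjK : involutive conj;
    conj_trace : forall x, x + conj x \in 1%VS;
    conj_norm : forall x, x * conj x \in 1%VS }.

Lemma canonical_involution1 (conj : {linear D -> D}) :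
  canonical_involution conj -> conj 1 = 1.
Proof.
move=> h; rewrite -[RHS](conjK h) -[in RHS](mulr1 (conj 1)) (conj_mul h).
by rewrite (conjK h) mulr1.
Qed.

Lemma canonical_involution_unique (f g : {linear D -> D}) :
  canonical_involution f -> canonical_involution g -> f =1 g.
Proof.
move=> hf hg x; have [/vlineP[k ->]|xF] := boolP (x \in 1%VS).
  rewrite !linearZ /=; congr (_ *: _).
  by rewrite (canonical_involution1 hf) (canonical_involution1 hg).
have /vlineP[a Ea] := conj_trace hf x; have /vlineP[b Eb] := conj_trace hg x.
have Ef : f x = a%:A - x by rewrite -Ea addrC addKr.
have Eg : g x = b%:A - x by rewrite -Eb addrC addKr.
have := memvB (conj_norm hf x) (conj_norm hg x).
rewrite -mulrBr Ef Eg opprB addrA subrK -scalerBl -scalerAr mulr1.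
rewrite rpredZeq (negPf xF) orbF subr_eq0 => /eqP->.
by [].
Qed.

Variables (conj : {linear D -> D}) (c : D).

(* The product of Cay(D, c) on D (+) D, not the canonical componentwise ring   *)
(* product on pairs.                                                           *)
Definition cay_mul (x y : D * D) : D * D :=
  (x.1 * y.1 + c * conj y.2 * x.2, y.2 * x.1 + x.2 * conj y.1).

Definition cay_one : D * D := (1, 0).

Definition cay_inl (u : D) : D * D := (u, 0).

Fact cay_inl_is_linear : linear cay_inl.
Proof. by move=> a u v; congr (_, _); rewrite /= scaler0 addr0. Qed.

HB.instance Definition _ :=
  GRing.isLinear.Build F D (D * D)%type *:%R cay_inl cay_inl_is_linear.

Definition cay_base : {vspace D * D} := (linfun cay_inl @: fullv)%VS.

Lemma mem_cay_base (x : D * D) : (x \in cay_base) = (x.2 == 0).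
Proof.
apply/memv_imgP/eqP => [[u _ ->]|x2]; first by rewrite lfunE.
by exists x.1; rewrite ?memvf // lfunE /= /cay_inl -x2 -surjective_pairing.
Qed.

End CayleyDickson.

Arguments cay_one {F} D.
Arguments cay_base {F} D.
Arguments division_algebra {F} D.

(* Main.v *)
(* For x = (u, v) in Cay(D, c), x^2 - T(u) x + N(u) = N(v) (c, 0).  If an       *)
(* associative subalgebra S contains some x with v <> 0, it therefore contains  *)
(* (c, 0), which commutes with x.  Those x span S, since the others form a      *)
(* proper subspace, so (c, 0) is central in S.  When S is a quaternion algebra  *)
(* this forces c in F; hence S is contained in D, and equal to it by dimension. *)
Require Import Defs.
From mathcomp Require Import all_boot all_order all_algebra all_field.

Import GRing.Theory.
Local Open Scope ring_scope.

(** What prevents a second quaternion subalgebra is [c] itself. An element of [S] outside [D]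
    satisfies a quadratic relation from which [(c, 0)] can be solved ([cay_quadratic]); this puts
    [(c, 0)] in the centre of [S], which is [F], against [c \notin 1%VS]. Hence [S] lies in [D]
    ([assoc_sub_cay_base]), and both have dimension 4. Conversely, the first summand is a copy of
    [D], so [cay_base_quaternion] carries the structure over. *)

Section CayleyDicksonTheory.

Variables (F : fieldType) (D : falgType F) (conj : {linear D -> D}) (c : D).

Local Notation mul := (cay_mul conj c).
Local Notation one := (cay_one D).

Lemma cay_mul_linl a (x y z : D * D) :
  mul (a *: x + y) z = a *: mul x z + mul y z.
Proof.
congr (_, _); rewrite /= ?mulrDl ?mulrDr ?scalerDr -?scalerAl -?scalerAr;
  exact: addrACA.
Qed.

Lemma cay_mul_linr a (x y z : D * D) :
  mul x (a *: y + z) = a *: mul x y + mul x z.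
Proof.
congr (_, _); rewrite /= linearP /= ?mulrDl ?mulrDr ?mulrDl ?scalerDr;
  rewrite -?scalerAl -?scalerAr -?scalerAl; exact: addrACA.
Qed.

Lemma cay_mul_inl (u v : D) : mul (u, 0) (v, 0) = (u * v, 0).
Proof. by rewrite /cay_mul /= mulr0 !mul0r !addr0. Qed.

(** Bilinearity alone makes the centralizer of [z] a subspace, so commutation can be checked on
    summands. *)
Lemma cay_comm_lin a (x y z : D * D) :
  mul x z = mul z x -> mul y z = mul z y ->
  mul (a *: x + y) z = mul z (a *: x + y).
Proof. by move=> xz yz; rewrite cay_mul_linl cay_mul_linr xz yz. Qed.

Hypotheses (hdiv : division_algebra D) (hconj : canonical_involution conj).

Lemma cay_mul1l (x : D * D) : mul one x = x.
Proof.
case: x => u v; rewrite /cay_mul /= mulr0 addr0 mul1r mulr1 mul0r; congr (_, _).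
exact: addr0.
Qed.

Lemma cay_mul1r (x : D * D) : mul x one = x.
Proof.
case: x => u v; rewrite /cay_mul /= linear0 mulr0 mul0r addr0 mulr1 mul0r add0r.
by rewrite (canonical_involution1 hconj) mulr1.
Qed.

Lemma cay_quadratic (x : D * D) : x.2 != 0 ->
  exists k a b : F, (c, 0) = k *: (a *: x + (b *: one + mul x x)).
Proof.
case: x => u v /= v0.
have /vlineP[t Et] := conj_trace hconj u.
have /vlineP[m Em] := conj_norm hconj u.
(* The square of [(u, v)] contains [conj v * v], which is the norm of [conj v]; it is nonzero
   because [D] is a division algebra. *)
have /vlineP[n] := conj_norm hconj (conj v); rewrite (conjK hconj) => En.
have cv0 : conj v != 0.
  by apply: contraNneq v0 => cv; rewrite -(conjK hconj v) cv linear0.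
have n0 : n != 0.
  apply/eqP => n0; move: En; rewrite n0 scale0r => /(congr1 ( *%R (conj v)^-1)).
  by rewrite mulKr ?hdiv // mulr0; apply/eqP.
exists n^-1, (- t), m.
congr (_, _) => /=.
  (* Cayley-Hamilton for [u], with trace [t] and norm [m]. *)
  have Nu : - t *: u + (m *: 1 + u * u) = 0.
    rewrite -Em -mulrDr (addrC (conj u)) Et -scalerAr mulr1 scaleNr; exact: addNr.
  rewrite -mulrA En -scalerAr mulr1 !addrA -(addrA (- t *: u)) Nu add0r.
  by rewrite scalerA mulVf // scale1r.
by rewrite scaler0 add0r -mulrDr Et -scalerAr mulr1 scaleNr addNr scaler0.
Qed.

Lemma assoc_sub_cay_base (S : {vspace D * D}) :
  assoc_unital_algebra mul one S -> central mul one S -> c \notin 1%VS ->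
  (S <= cay_base D)%VS.
Proof.
move=> [[S1 SM] _ _ _ _ Sassoc] Scent cF; apply/subvP => x Sx.
rewrite mem_cay_base; apply: contraNT cF => x2.
(* Here [(c, 0)] is a combination of [y], the unit and the square of [y]; associativity of [S] makes
   [y] commute with its square. *)
have comm y : y \in S -> y.2 != 0 -> mul y (c, 0) = mul (c, 0) y.
  move=> Sy /(cay_quadratic y)[k [a [b ->]]]; rewrite -[k *: _]addr0.
  have cy0 : mul 0 y = mul y 0.
    have := cay_mul_linl (- 1) 0 0 y; have := cay_mul_linr (- 1) y 0 0.
    by rewrite !scaleN1r oppr0 addr0 !addNr => -> ->.
  apply/esym/cay_comm_lin => //; apply/cay_comm_lin => //.
  apply/cay_comm_lin; first by rewrite cay_mul1l cay_mul1r.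
  by rewrite Sassoc.
have Sc : (c, 0) \in S.
  have [k [a [b ->]]] := cay_quadratic _ x2.
  by rewrite !(memvD, memvZ) ?SM.
have /vlineP[k [->]] : (c, 0) \in <[one]>%VS.
  apply: Scent => // y Sy; apply/esym.
  have [y2|] := eqVneq y.2 0; last exact: comm.
  (* If [y] lies in [D], then [y = - x + (x + y)], where both [x] and [x + y] lie outside [D]. *)
  rewrite -[y](addKr x) -scaleN1r; apply: cay_comm_lin; first exact: comm.
  by apply: comm; rewrite ?memvD //= y2 addr0.
by rewrite memvZ ?mem1v ?memv_line.
Qed.

Lemma dim_cay_base : \dim (cay_base D) = \dim {:D}.
Proof.
apply: limg_dim_eq; apply/eqP; rewrite -subv0; apply/subvP => u.
rewrite memv_cap memv_ker lfunE /= memv0 => /andP[_ /eqP[->]]; exact: eqxx.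
Qed.

Lemma cay_base_subalgebra : unital_subalgebra mul one (cay_base D).
Proof.
split=> [|x y]; rewrite !mem_cay_base //= => /eqP-> /eqP->.
by rewrite !mul0r addr0.
Qed.

Lemma cay_base_quaternion :
  quaternion_algebra (fun x y : D => x * y) 1 fullv ->
  quaternion_algebra mul one (cay_base D).
Proof.
move=> [_ Ddim Dcent [_ Dsimple]].
have baseP (x : D * D) : x \in cay_base D -> x = (x.1, 0).
  by rewrite mem_cay_base => /eqP <-; case: x.
have inl_base u : (u, 0) \in cay_base D by rewrite mem_cay_base.
split.
- split=> [|a x y z _ _ _|a x y z _ _ _|x _|x _|x y z].
  + exact: cay_base_subalgebra.
  + exact: cay_mul_linl.
  + exact: cay_mul_linr.
  + exact: cay_mul1l.
  + exact: cay_mul1r.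
  + by move=> /baseP-> /baseP-> /baseP->; rewrite !cay_mul_inl mulrA.
- by rewrite dim_cay_base.
- move=> x /baseP-> xcomm.
  have /vlineP[k ->] : x.1 \in <[1]>%VS.
    apply: Dcent => [|y _]; first exact: memvf.
    by have := xcomm _ (inl_base y); rewrite !cay_mul_inl => -[].
  by apply/vlineP; exists k; congr (_, _); rewrite /= scaler0.
- split=> [D0|I [ID Il Ir]]; first by have := dim_cay_base; rewrite D0 dimv0 Ddim.
  (* Simplicity transfers by pulling [I] back to an ideal of [D]; [I] is recovered as its image
     since it lies in [cay_base D]. *)
  have memJ u : (u \in linfun (@cay_inl F D) @^-1: I)%VS = ((u, 0) \in I).
    by rewrite -memv_preim lfunE.
  have EI : I = (linfun (@cay_inl F D) @: (linfun (@cay_inl F D) @^-1: I))%VS.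
    by rewrite lpreimK.
  have [|J0|JD] := Dsimple (linfun (@cay_inl F D) @^-1: I)%VS.
  + split=> [|x y _|x y]; rewrite ?subvf // !memJ -cay_mul_inl => Iy.
      exact: Il.
    by move=> _; apply: Ir.
  + by left; rewrite EI J0 limg0.
  + by right; rewrite EI JD.
Qed.

End CayleyDicksonTheory.

Theorem theorem8 (F : fieldType) (D : falgType F)
    (hquat : quaternion_algebra (fun x y : D => x * y) 1 fullv)
    (hdiv : division_algebra D)
    (conj : {linear D -> D}) (hconj : canonical_involution conj)
    (c : D) (hcunit : c \is a GRing.unit) (hcF : c \notin 1%VS)
    (S : {vspace D * D}) :
  quaternion_subalgebra (cay_mul conj c) (cay_one D) S <-> S = cay_base D.
Proof.
split=> [[_ [Salg Sdim Scent _]]|->].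
  apply/eqP; rewrite eqEdim dim_cay_base (quat_dim hquat) Sdim leqnn andbT.
  exact: (assoc_sub_cay_base _ _ _ _ hdiv hconj _ Salg Scent hcF).
split; first exact: cay_base_subalgebra.
exact: cay_base_quaternion.
Qed.
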